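(* Every finite simple connected closed graph is narrow.
   Context: A labeling of a graph $G$ with $n$ vertices is a bijection $V(G)\to[n]$, identified with $V(G)=[n]$. It is closed if whenever $\{j,i\},\{i,k\}$ are distinct edges with either ($j>i$ and $k>i$) or ($j<i$ and $k<i$), then $\{j,k\}\in E(G)$; a graph is closed if it has a closed labeling. For a connected graph, $d(v,w)$ is shortest-path distance, $\mathrm{diam}(G)=\max_{v,w}d(v,w)$, and a longest shortest path is a shortest path connecting two vertices at distance $\mathrm{diam}(G)$. A connected graph is narrow if for every vertex $v$ and every longest shortest path $P$, either $v\in V(P)$ or $v$ is adjacent to a vertex of $P$. *)

(* Defs.v *)
From mathcomp Require Import all_boot all_order.

Set Implicit Arguments.
Unset Strict Implicit.
Unset Printing Implicit Defensive.

(* A finite simple graph is a symmetric irreflexive relation [e] on a finType. *)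

Section Graphs.

Variables (T : finType) (e : rel T).

Definition connected_graph : Prop := forall x y : T, connect e x y.

(* The labels are 0, ..., n-1 instead of 1, ..., n; only their order matters.
   When [e j i] and [e i k], the edges {j,i} and {i,k} are distinct iff
   [j != k]. *)
Definition closed_labeling (f : T -> 'I_#|T|) : Prop :=
  bijective f /\
  forall i j k : T, e j i -> e i k -> j != k ->
    (f i < f j /\ f i < f k) \/ (f j < f i /\ f k < f i) -> e j k.

Definition closed_graph : Prop :=
  exists f : T -> 'I_#|T|, closed_labeling f.

(* The vertices of the path are [x :: p] and its length is [size p]. *)
Definition gpath (x y : T) (p : seq T) : bool :=
  [&& path e x p, last x p == y & uniq (x :: p)].

(* A path with distinct vertices has length less than [#|T|], so this is the
   shortest-path distance when [x] and [y] are connected ([#|T|] otherwise). *)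
Definition dist (x y : T) : nat :=
  find (fun n => [exists p : n.-tuple T, gpath x y p]) (iota 0 #|T|).

Definition diam : nat := \max_(x : T) \max_(y : T) dist x y.

Definition shortest_path (x y : T) (p : seq T) : Prop :=
  gpath x y p /\ size p = dist x y.

Definition longest_shortest_path (x y : T) (p : seq T) : Prop :=
  shortest_path x y p /\ dist x y = diam.

Definition narrow : Prop :=
  forall (v x y : T) (p : seq T), longest_shortest_path x y p ->
    v \in x :: p \/ exists2 u : T, u \in x :: p & e v u.

End Graphs.

(* Main.v *)
Require Import Defs.
From mathcomp Require Import all_boot all_order.

(** Only the order [r] on the vertices induced by a closed labeling matters, and
    the hypotheses on it are self-dual. Shortcutting local extrema turns any
    path into a monotone one that is no longer; hence, in a connected graph, an
    edge [a -- b] makes every vertex lying between [a] and [b] adjacent to both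
    ends. Let [P] be a longest shortest path from [x] to [y]. If [v] lies
    between [x] and [y], some edge of [P] jumps over [v], so [v] is adjacent to
    [P]. Otherwise, up to duality and reversal of [P], [v < x < y]; a shortest
    monotone path from [v] to [y] jumps over [x] and, unless [v] is adjacent to
    [x], rerouting it through [x] at the jump shows [d(x,y) < d(v,y)], against
    the maximality of [d(x,y)]. *)

Set Implicit Arguments.
Unset Strict Implicit.
Unset Printing Implicit Defensive.

Section Distance.

Variables (T : finType) (e : rel T).

Lemma dist_le_size x p : path e x p -> dist e x (last x p) <= size p.
Proof.
move=> ep; case: (shortenP ep) => q eq_ uq sub_qp.
have le_qp : size q <= size p by apply: uniq_leq_size (sub_qp); case/andP: uq.
apply: leq_trans le_qp.
have lt_qT : size q < #|T| by have := max_card (mem (x :: q)); rewrite (card_uniqP uq).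
(* If [size q] were smaller than the distance, the search would have rejected it, yet [q] itself is
   a witness; [lt_qT] identifies the index with the value of [iota]. *)
rewrite leqNgt; apply/negP => /(before_find 0).
rewrite nth_iota // add0n => /existsP[]; exists (in_tuple q).
by rewrite /gpath eq_ eqxx.
Qed.

Lemma dist_path x y : connect e x y ->
  exists p, [/\ path e x p, last x p = y & size p = dist e x y].
Proof.
case/connectP=> p ep ->; case: (shortenP ep) => q eq_ uq _.
set P := fun n => [exists p : n.-tuple T, gpath e x (last x q) p].
have lt_qT : size q < #|T| by have := max_card (mem (x :: q)); rewrite (card_uniqP uq).
(* The search succeeds, so [find] does not return its default [#|T|]. *)
have hasP : has P (iota 0 #|T|).
  apply/hasP; exists (size q); first by rewrite mem_iota.
  by apply/existsP; exists (in_tuple q); rewrite /gpath eq_ eqxx.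
have := nth_find 0 hasP; rewrite nth_iota; last first.
  by move: hasP; rewrite has_find size_iota.
rewrite add0n => /existsP[t /and3P[et /eqP lt _]].
by exists t; rewrite size_tuple.
Qed.

Lemma dist_le_diam x y : dist e x y <= diam e.
Proof.
rewrite /diam (bigD1 x) //= leq_max; apply/orP; left.
by rewrite (bigD1 y) //= leq_max leqnn.
Qed.

Lemma path_reverse x p : symmetric e -> path e x p ->
  exists q, [/\ path e (last x p) q, last (last x p) q = x & size q = size p].
Proof.
move=> e_sym ep; exists (rev (belast x p)); split.
- by rewrite rev_path (eq_path (e' := e)) // => a b; rewrite /= e_sym.
- by case: p {ep} => //= a p; rewrite rev_cons last_rcons.
- by rewrite size_rev size_belast.
Qed.

End Distance.

Definition closed_order (T : finType) (e r : rel T) : Prop :=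
  [/\ transitive r, irreflexive r, forall x y, x != y -> r x y || r y x
    & forall i j k, e j i -> e i k -> j != k ->
        (r i j /\ r i k) \/ (r j i /\ r k i) -> e j k].

Lemma closed_order_dual (T : finType) (e r : rel T) :
  closed_order e r -> closed_order e (fun x y => r y x).
Proof.
case=> tr irr tot cl; split=> //.
- by move=> y x z ryx rzy; apply: tr rzy ryx.
- by move=> x y /tot; rewrite orbC.
- by move=> i j k eji eik njk [] ?; apply: (cl i) => //; [right|left].
Qed.

Lemma closed_labeling_order (T : finType) (e : rel T) (f : T -> 'I_#|T|) :
  closed_labeling e f -> closed_order e (fun x y => f x < f y).
Proof.
case=> /bij_inj f_inj cl; split=> //.
- by move=> y x z; apply: ltn_trans.
- by move=> x; apply: ltnn.
- by move=> x y; rewrite -neq_ltn; apply: contra => /eqP/val_inj/f_inj->.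
Qed.

Definition up_step (T : Type) (e r : rel T) : rel T :=
  fun a b => e a b && r a b.

Lemma up_path_path (T : Type) (e r : rel T) x q :
  path (up_step e r) x q -> path e x q.
Proof. by apply: sub_path => a b /andP[]. Qed.

Lemma up_path_last (T : eqType) (e r : rel T) x q : transitive r ->
  path (up_step e r) x q -> last x q = x \/ r x (last x q).
Proof.
move=> tr; elim: q x => [|a q IH] x /=; first by left.
by case/andP=> /andP[_ rxa] /IH[->|ra]; right=> //; apply: tr ra.
Qed.

(** Make the tail after [z] monotone. If the edge from [x] to [z] goes the other way, [z] is a local
    extremum; closedness lets the path skip it, and the shorter path is treated again. As that path
    still starts at [x], the induction is on length, not on the sequence. *)
Lemma monotone_path (T : finType) (e r : rel T) x p :
  irreflexive e -> closed_order e r -> path e x p ->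
  exists q, [/\ last x q = last x p, size q <= size p
    & path (up_step e r) x q \/ path (up_step e (fun a b => r b a)) x q].
Proof.
move=> e_irr [tr irr tot cl].
have [n] := ubnP (size p); elim: n => // n IH in x p *.
case: p => [|z p] /=; first by exists [::]; split=> //; left.
rewrite ltnS => lt_pn /andP[exz ep].
have [q [<- le_qp mono_q]] := IH _ _ lt_pn ep.
have nxz : x != z by apply: contraTneq exz => ->; rewrite e_irr.
case: q => [|w q] /= in le_qp mono_q *.
  exists [:: z]; split=> //; rewrite /= /up_step exz /= !andbT.
  by apply/orP; apply: tot.
have shortcut : e z w -> path e w q ->
    (r z x /\ r z w) \/ (r x z /\ r w z) ->
    exists q', [/\ last x q' = last w q, size q' <= (size p).+1
    & path (up_step e r) x q' \/ path (up_step e (fun a b => r b a)) x q'].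
  move=> ezw eq_ ext.
  (* Closedness needs distinct neighbours of [z]; if [x = w], both edges at [z] are dropped
     instead. *)
  have [exw|nxw] := eqVneq x w.
    rewrite -exw in eq_ *.
    have [|q' [/= <- le_q' mono]] := IH x q _ eq_.
      by apply: leq_trans lt_pn; apply: leqW.
    by exists q'; split=> //; apply: leq_trans le_q' _; apply/ltnW/leqW.
  have exw := cl _ _ _ exz ezw nxw ext.
  have [||q' [/= <- le_q' mono]] := IH x (w :: q).
  - exact: leq_ltn_trans lt_pn.
  - by rewrite /= exw.
  by exists q'; split=> //; apply: leqW; apply: leq_trans le_q' _.
case: mono_q => /andP[/andP[ezw rzw] mq]; have eq_ := up_path_path mq.
- case/orP: (tot _ _ nxz) => [rxz|rzx].
  + by exists [:: z, w & q]; split=> //; left; rewrite /= /up_step exz rxz ezw rzw.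
  + by apply: shortcut => //; left.
- case/orP: (tot _ _ nxz) => [rxz|rzx].
  + by apply: shortcut => //; right.
  + by exists [:: z, w & q]; split=> //; right; rewrite /= /up_step exz rzx ezw rzw.
Qed.

Section ConnectedClosedOrder.

Variables (T : finType) (e : rel T).
Hypotheses (e_sym : symmetric e) (e_irr : irreflexive e).
Hypothesis e_conn : connected_graph e.

Lemma up_path_dist r x y : closed_order e r -> r x y ->
  exists q, [/\ path (up_step e r) x q, last x q = y & size q <= dist e x y].
Proof.
move=> cr rxy; have [tr irr _ _] := cr.
have [p [ep lp <-]] := dist_path (e_conn x y).
have [q [lq le_qp [mq|mq]]] := monotone_path e_irr cr ep.
  by exists q; rewrite lq.
have [tr' _ _ _] := closed_order_dual cr.
(* A decreasing path would end at [x] or below it. *)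
have := up_path_last tr' mq; rewrite lq lp => -[exy|ryx].
  by rewrite exy irr in rxy.
by have := tr _ _ _ rxy ryx; rewrite irr.
Qed.

(** Climb an increasing path from [i] to [k]: the next vertex and [j] are both upper neighbours of
    the current one, so closedness carries the edge to [j] along. *)
Lemma edge_between r i j k : closed_order e r ->
  e i j -> r i k -> r k j -> e k j.
Proof.
move=> cr eij rik rkj; have [tr irr _ cl] := cr.
have [q [mq lq _]] := up_path_dist cr rik.
(* [r i k] fails once [i] reaches [k]; the invariant kept is [r i j]. *)
have {rik} rij := tr _ _ _ rik rkj.
elim: q i => [|a q IH] i /= in mq lq eij rij *; first by rewrite -lq.
case/andP: mq => /andP[eia ria] mq.
have raj : r a j.
  by have := up_path_last tr mq; rewrite lq => -[<-//|rak]; apply: tr rkj.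
apply: (IH a) => //; apply: (cl i) => //; first by rewrite e_sym.
- by apply: contraTneq raj => ->; rewrite irr.
- by left.
Qed.

Lemma edge_between_low r i j k : closed_order e r ->
  e i j -> r i k -> r k j -> e i k.
Proof.
move=> cr eij rik rkj; rewrite e_sym.
by apply: (edge_between (closed_order_dual cr) (i := j)); rewrite 1?e_sym.
Qed.

(** The first vertex of the path not below [v] is [v] itself or is entered by an edge jumping over
    [v]. *)
Lemma crossing_path r v x p : closed_order e r ->
  path e x p -> r x v -> r v (last x p) ->
  v \in x :: p \/ exists2 u, u \in x :: p & e v u.
Proof.
move=> cr; have [tr irr tot _] := cr.
elim: p x => [|a p IH] x /=.
  by move=> _ rxv /(tr _ _ _ rxv); rewrite irr.
case/andP=> exa ep rxv rvl.
have [->|nav] := eqVneq v a; first by left; rewrite !inE eqxx orbT.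
case/orP: (tot _ _ nav) => [rva|rav].
  right; exists x; first exact: mem_head.
  by rewrite e_sym; apply: edge_between_low exa rxv rva.
by case: (IH a ep rav rvl) => [vp|[u up evu]]; [left | right; exists u => //];
  rewrite inE ?vp ?up orbT.
Qed.

(** At the edge of [q] that jumps over [x], its upper end is adjacent to [x], so [x] can replace its
    lower end and everything before. *)
Lemma up_path_reroute r v x y q : closed_order e r ->
  r v x -> r x y -> path (up_step e r) v q -> last v q = y ->
  exists q', [/\ path e x q', last x q' = y & size q' <= size q].
Proof.
move=> cr rvx rxy; have [tr irr tot _] := cr.
elim: q v rvx => [|w q IH] v rvx /=.
  by move=> _ evy; have := tr _ _ _ rvx rxy; rewrite evy irr.
case/andP=> /andP[evw rvw] mq lq.
have [exw|nxw] := eqVneq x w.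
  by exists q; rewrite exw; split=> //; apply: up_path_path mq.
case/orP: (tot _ _ nxw) => [rxw|rwx].
  exists (w :: q); split=> //=.
  by rewrite (edge_between cr evw) // (up_path_path mq).
by have [q' [? ? le_q']] := IH w rwx mq lq; exists q'; split=> //; apply: leqW.
Qed.

Lemma adjacent_or_farther r v x y : closed_order e r ->
  r v x -> r x y -> e v x \/ dist e x y < dist e v y.
Proof.
move=> cr rvx rxy; have [tr irr tot _] := cr.
have [[|w q] [/= mq lq le_q]] := up_path_dist cr (tr _ _ _ rvx rxy).
  by have := tr _ _ _ rvx rxy; rewrite lq irr.
case/andP: mq => /andP[evw rvw] mq.
have [exw|nxw] := eqVneq x w; first by left; rewrite exw.
case/orP: (tot _ _ nxw) => [rxw|rwx].
  by left; apply: edge_between_low evw rvx rxw.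
right; have [q' [eq' lq' le_q']] := up_path_reroute cr rwx rxy mq lq.
apply: leq_trans le_q; rewrite ltnS; apply: leq_trans le_q'.
by rewrite -lq'; apply: dist_le_size.
Qed.

Lemma dist_sym x y : dist e x y = dist e y x.
Proof.
suff le a b : dist e a b <= dist e b a by apply/eqP; rewrite eqn_leq !le.
have [p [ep lp <-]] := dist_path (e_conn b a).
have [q [eq_ lq <-]] := path_reverse e_sym ep.
by rewrite lp in eq_ lq; rewrite -lq; apply: dist_le_size.
Qed.

Lemma below_diametral_pair r v x y : closed_order e r ->
  dist e x y = diam e -> r v x -> r v y -> e v x \/ e v y.
Proof.
move=> cr dxy rvx rvy; have [tr irr tot _] := cr.
(* If [x = y], the diameter is 0, which forces [v = x]. *)
have [exy|nxy] := eqVneq x y.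
  move: dxy; rewrite -exy => dxx.
  have dvx : dist e v x <= 0.
    apply: leq_trans (dist_le_diam e v x) _.
    by rewrite -dxx; apply: (dist_le_size (p := [::])).
  have [[|a p] [_ /= evx sz]] := dist_path (e_conn v x).
    by rewrite evx irr in rvx.
  by rewrite -sz in dvx.
case/orP: (tot _ _ nxy) => [rxy|ryx].
  case: (adjacent_or_farther cr rvx rxy) => [|lt]; first by left.
  by have := leq_trans lt (dist_le_diam e v y); rewrite dxy ltnn.
case: (adjacent_or_farther cr rvy ryx) => [|lt]; first by right.
by have := leq_trans lt (dist_le_diam e v x); rewrite dist_sym dxy ltnn.
Qed.

Lemma closed_order_narrow r : closed_order e r -> narrow e.
Proof.
move=> cr v x y p [[/and3P[ep /eqP lp _] _] dxy].
have [_ _ tot _] := cr; have cr' := closed_order_dual cr.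
have xp : x \in x :: p := mem_head x p.
have yp : y \in x :: p by rewrite -lp mem_last.
have [->|nvx] := eqVneq v x; first by left.
have [->|nvy] := eqVneq v y; first by left.
have adj : e v x \/ e v y -> v \in x :: p \/ exists2 u, u \in x :: p & e v u.
  by case=> evu; right; [exists x | exists y].
(* In order: [v] is below both ends, between them with [y] lower, between them with [x] lower, above
   both. *)
case/orP: (tot _ _ nvx) => rx; case/orP: (tot _ _ nvy) => ry.
- exact/adj/(below_diametral_pair cr).
- by apply: (crossing_path cr') => //; rewrite lp.
- by apply: (crossing_path cr) => //; rewrite lp.
- exact/adj/(below_diametral_pair cr').
Qed.

End ConnectedClosedOrder.

Theorem theorem2p7 (T : finType) (e : rel T)
  (e_sym : symmetric e) (e_irr : irreflexive e) :
  connected_graph e -> closed_graph e -> narrow e.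
Proof.
move=> e_conn [f /closed_labeling_order cf].
exact: (closed_order_narrow e_sym e_irr e_conn cf).
Qed.
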